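(* Let $X$ be a filtered diffeological space. Then $T^H X$ is a diffeological vector space over $X$. Therefore, $T^H X$ and $T^{dvs} X$ agree (as diffeological spaces). Moreover, for each $x \in X$, the internal tangent space $T_x(X)$, with the sub-diffeology from $T^H X = T^{dvs}X$, has the fine diffeology.
   Context: A diffeological space is a set $X$ with, for each $n \ge 0$ and each open $U \subseteq \mathbb{R}^n$, a specified set of functions $U \to X$ called plots, such that: every constant function $U\to X$ is a plot; if $U \to X$ is a plot and $V \to U$ is a smooth map between open subsets of Euclidean spaces, the composite $V \to X$ is a plot; and a function $U \to X$ whose restriction to each member of some open cover of $U$ is a plot is itself a plot. A function $f : X \to Y$ is smooth if $f \circ p$ is a plot of $Y$ for every plot $p$ of $X$. A subset $A \subseteq X$ carries the sub-diffeology (plots are the functions $U \to A$ whose composite to $X$ is a plot); products and pullbacks carry the product diffeology and its sub-diffeology. A pointed plot $p : (U,0) \to (X,x)$ is a plot $p:U\to X$ where $U$ is a connected open neighbourhood of $0$ in some $\mathbb{R}^n$ and $p(0) = x$. The germ category $\mathcal{G}(X,x)$ has the pointed plots as objects; a morphism from $p : (U,0)\to (X,x)$ to $q : (V,0) \to (X,x)$ is the germ at $0$ of a smooth map $f : W \to V$, with $W$ an open neighbourhood of $0$ in $U$, $f(0)=0$ and $p|_W = q \circ f$. The internal tangent space $T_x(X)$ is the colimit, in real vector spaces, of the functor $\mathcal{G}(X,x) \to \mathrm{Vect}$ sending $p : (U,0) \to (X,x)$ to $T_0(U)$ and a germ $f$ to its derivative at $0$. A category $\mathcal{C}$ is filtered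 if it is non-empty, any two objects $C, D$ admit morphisms $C \to E$ and $D \to E$ to a common object $E$, and for any parallel morphisms $f,g : C \to D$ there is a morphism $h : D \to E$ with $h\circ f = h \circ g$. A pointed diffeological space $(X,x)$ is filtered if $\mathcal{G}(X,x)$ is filtered; a diffeological space $X$ is filtered if $(X,x)$ is filtered for every $x \in X$. Let $TX = \coprod_{x \in X} T_x(X)$ with projection to $X$. For a plot $p : U \to X$, let $Tp : TU \to TX$ send $v \in T_u U$ to the element of $T_{p(u)}(X)$ represented by $v$ at the pointed plot $w \mapsto p(u+w)$ (defined near $0$). $T^H X$ (Hector's diffeology) is $TX$ with the smallest diffeology making all $Tp$ smooth; its plots are the functions that locally are constant or of the form $Tp \circ f$ with $f : U' \to TU$ smooth. A diffeology on $TX$ makes it a diffeological vector space over $X$ if the projection to $X$, the fiberwise addition $TX \times_X TX \to TX$ and the scalar multiplication $TX \times \mathbb{R} \to TX$ are smooth (the projection $T^HX\to X$ is always smooth). $T^{dvs} X$ is $TX$ with the smallest diffeology containing Hector's diffeology and making $TX$ a diffeological vector space over $X$. A diffeological vector space is a real vector space with a diffeology for which addition and scalar multiplication are smooth. The fine diffeology on a vector space $V$ is the smallest diffeology on $V$ making it a diffeological vector space. *)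

(* Defs.v *)
From HB Require Import structures.
From mathcomp Require Import all_boot all_order all_algebra.
From mathcomp Require Import all_classical all_reals all_analysis.
Set Implicit Arguments.
Unset Strict Implicit.
Unset Printing Implicit Defensive.
Import Order.TTheory GRing.Theory Num.Theory.
Import numFieldNormedType.Exports.
Local Open Scope classical_set_scope.
Local Open Scope ring_scope.

Section smooth.
Context {R : realType}.
Implicit Types V W : normedModType R.

(* f is C^oo on the open set U: all its iterated directional derivatives exist
   and are differentiable at every point of U. *)
Definition smooth_on V W (U : set V) (f : V -> W) :=
  forall (s : seq V) x, U x -> differentiable (foldl (fun g v => 'D_v g) f s) x.

Fixpoint Ck (k : nat) V W (U : set V) (f : V -> W) : Prop :=
  (forall x, U x -> differentiable f x) /\
  (if k is k'.+1 then forall v, Ck k' U ('D_v f) else True).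

Lemma Ck_diff k V W (U : set V) (f : V -> W) x :
  Ck k U f -> U x -> differentiable f x.
Proof. by case: k => [|k] [+ _]; apply. Qed.

Lemma CkW k V W (U : set V) (f : V -> W) : Ck k.+1 U f -> Ck k U f.
Proof.
elim: k f => [|k IH] f; first by move=> [fU _]; split.
by move=> [fU Df]; split => // v; apply: IH; exact: Df.
Qed.

Lemma smooth_onP V W (U : set V) (f : V -> W) :
  smooth_on U f <-> forall k, Ck k U f.
Proof.
split=> [fs k|fs s].
  elim: k f fs => [|k IH] f fs; split => //; try exact: (fs [::]).
  by move=> v; apply: IH => s; exact: (fs (v :: s)).
elim: s f fs => [|v s IH] f fs x Ux; first by have [+ _] := fs 0%N; apply.
by apply: (IH ('D_v f)) => // k; have [_ +] := fs k.+1; apply.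
Qed.

Lemma near_differentiable V W (f g : V -> W) x :
  (\forall z \near x, f z = g z) -> differentiable f x -> differentiable g x.
Proof.
move=> fg fd; have /diff_locallyP [dfc dfe] := fd.
have gx : g x = f x by rewrite (nbhs_singleton fg).
have ge : g \o shift x = cst (g x) + 'd f x +o_ 0 id.
  apply/eqaddoP => _/posnumP[e]; move/eqaddoP: dfe => /(_ e%:num (ltac:(done))).
  apply: filterS2 (_ : \forall h \near 0, f (h + x) = g (h + x)) => /=.
    by move=> h; rewrite /= !fctE /= gx => ->.
  rewrite (near_shift x 0) /=; apply: filterS fg => z /=.
  by rewrite sub0r subrK.
by apply/diff_locallyP; rewrite (diff_unique dfc ge).
Qed.

Lemma dscaling V W (a : V -> R) (f : V -> W) x :
  differentiable a x -> differentiable f x ->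
  differentiable (fun z => a z *: f z) x /\
  forall v, 'D_v (fun z => a z *: f z) x = 'D_v a x *: f x + a x *: 'D_v f x.
Proof.
move=> da df.
have bl : bilinear_for (GRing.Scale.Law.clone _ _ *:%R _)
    (GRing.Scale.Law.clone _ _ *:%R _) (fun (r : R) (w : W) => r *: w).
  split=> [u'|u] b y z /=.
  - by rewrite scalerDl scalerA.
  - by rewrite scalerDr !scalerA mulrC.
pose blM := bilinear_isBilinear.Build R R W W _ _ _ bl.
pose B : {bilinear R -> W -> W} := HB.pack (fun (r : R) (w : W) => r *: w) blM.
have Bc : continuous (fun p : R * W => B p.1 p.2) by exact: scale_continuous.
have dB p : differentiable (fun p : R * W => B p.1 p.2) p.
  exact: differentiable_bilin.
have eB p : 'd (fun p : R * W => p.1 *: p.2) p =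
    (fun q => p.1 *: q.2 + q.1 *: p.2) :> (R * W -> W).
  exact: (@diff_bilin _ _ _ _ B p Bc).
have dp : differentiable (fun z => (a z, f z)) x by exact: differentiable_pair.
have dc : differentiable (fun z => a z *: f z) x.
  exact: (differentiable_comp dp (dB _)).
split=> // v.
rewrite deriveE // (@diff_comp _ _ _ _ (fun z => (a z, f z))
  (fun p : R * W => p.1 *: p.2)) //=.
rewrite eB diff_pair //= !deriveE //.
by rewrite addrC.
Qed.

Lemma near_open_eq V W (U : set V) (f g : V -> W) x : open U ->
  (forall z, U z -> f z = g z) -> U x -> \forall z \near x, f z = g z.
Proof.
by move=> Uo fg Ux; apply: filterS fg (open_nbhs_nbhs (conj Uo Ux)).
Qed.

Lemma Ck_eq k V W (U : set V) (f g : V -> W) : open U ->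
  (forall x, U x -> f x = g x) -> Ck k U f -> Ck k U g.
Proof.
move=> Uo; elim: k f g => [|k IH] f g fg [fd Df]; split=> //.
- move=> x Ux; apply: near_differentiable (near_open_eq Uo fg Ux) _.
  exact: fd.
- move=> x Ux; apply: near_differentiable (near_open_eq Uo fg Ux) _.
  exact: fd.
- move=> v; apply: IH (Df v) => x Ux; apply: near_eq_derive.
  exact: near_open_eq Ux.
Qed.

Lemma Ck_cst k V W (U : set V) (w : W) : open U -> Ck k U (cst w : V -> W).
Proof.
move=> Uo; elim: k w => [|k IH] w; split=> //.
by move=> v; apply: Ck_eq (IH 0) => // x _; rewrite derive_cst.
Qed.

Lemma Ck_lin k V V' W (U : set V) (f : V -> V') (l : {linear V' -> W}) :
  open U -> continuous l -> Ck k U f -> Ck k U (l \o f).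
Proof.
move=> Uo lc; have dl y : differentiable l y by exact: linear_differentiable.
elim: k f => [|k IH] f [fd Df]; split=> //.
- by move=> x Ux; apply: differentiable_comp; [exact: fd|].
- by move=> x Ux; apply: differentiable_comp; [exact: fd|].
- move=> v; apply: Ck_eq (IH _ (Df v)) => // x Ux /=.
  have dlf := differentiable_comp (fd x Ux) (dl (f x)).
  have /(congr1 (fun h => h v)) := diff_comp (fd x Ux) (dl (f x)).
  rewrite (deriveE v (fd x Ux)) (deriveE v dlf) => -> /=.
  by rewrite (diff_lin (f x) lc).
Qed.

Lemma Ck_sum k V W (U : set V) n (f : 'I_n -> V -> W) : open U ->
  (forall i, Ck k U (f i)) -> Ck k U (\sum_(i < n) f i).
Proof.
move=> Uo; elim: k f => [|k IH] f fk; split=> //.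
- by move=> x Ux; apply: differentiable_sum => i; exact: Ck_diff (fk i) Ux.
- by move=> x Ux; apply: differentiable_sum => i; exact: Ck_diff (fk i) Ux.
- move=> v; apply: Ck_eq (IH (fun i => 'D_v (f i)) _) => //.
    move=> x Ux; rewrite derive_sum ?fct_sumE // => i.
    by apply: diff_derivable; exact: Ck_diff (fk i) Ux.
  by move=> i; have [_] := fk i; apply.
Qed.

Lemma Ck_scaling k V W (U : set V) (a : V -> R) (f : V -> W) : open U ->
  Ck k U a -> Ck k U f -> Ck k U (fun z => a z *: f z).
Proof.
move=> Uo; elim: k a f => [|k IH] a f ak fk; split=> //.
- by move=> x Ux; have [] := dscaling (Ck_diff ak Ux) (Ck_diff fk Ux).
- by move=> x Ux; have [] := dscaling (Ck_diff ak Ux) (Ck_diff fk Ux).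
move=> v; have [_ /(_ v) Da] := ak; have [_ /(_ v) Df] := fk.
pose F := fun i : 'I_2 => if i == ord0 then fun z => 'D_v a z *: f z
                          else fun z => a z *: 'D_v f z.
apply: (@Ck_eq _ _ _ _ (\sum_(i < 2) F i)) => //.
  move=> x Ux; rewrite big_ord_recl big_ord1 /F /=.
  by have [_ ->] := dscaling (Ck_diff ak Ux) (Ck_diff fk Ux).
apply: Ck_sum => // i; rewrite /F; case: ifP => _; apply: IH => //; exact: CkW.
Qed.

Lemma Ck_comp k m n W (U : set 'rV[R]_n) (V : set 'rV[R]_m)
    (f : 'rV[R]_n -> W) (g : 'rV[R]_m -> 'rV[R]_n) :
  open U -> open V -> (forall z, V z -> U (g z)) ->
  (forall j, Ck j U f) -> (forall j, Ck j V g) -> Ck k V (f \o g).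
Proof.
move=> Uo Vo gVU fs gs; elim: k f fs => [|k IH] f fs; split=> //.
- move=> z Vz; apply: differentiable_comp; first exact: Ck_diff (gs 0%N) Vz.
  by apply: Ck_diff (fs 0%N) _; exact: gVU.
- move=> z Vz; apply: differentiable_comp; first exact: Ck_diff (gs 0%N) Vz.
  by apply: Ck_diff (fs 0%N) _; exact: gVU.
move=> v; pose e i : 'rV[R]_n := delta_mx 0 i.
apply: (@Ck_eq _ _ _ _
    (\sum_(i < n) (fun z => ('D_v g z) 0 i *: ('D_(e i) f \o g) z))) => //.
  move=> z Vz; have dg := Ck_diff (gs 0%N) Vz.
  have df := Ck_diff (fs 0%N) (gVU _ Vz).
  have dfg := differentiable_comp dg df.
  rewrite fct_sumE (deriveE v dfg) diff_comp //= -(deriveE v dg)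
    {2}(row_sum_delta ('D_v g z)) linear_sum.
  apply: eq_bigr => i _ /=; rewrite (deriveE (e i) df).
  exact: (esym (linearZ _ _)).
apply: (Ck_sum (f := fun i z => ('D_v g z) 0 i *: ('D_(e i) f \o g) z)) => // i.
apply: Ck_scaling => //.
  have @l : {linear 'rV[R]_n -> R}.
    by exists (fun N : 'rV[R]_n => N 0 i); do 2![eexists]; do ?[constructor];
      rewrite ?mxE// => ? *; rewrite ?mxE//; move=> ?; rewrite !mxE.
  apply: (@Ck_lin _ _ _ _ _ ('D_v g) l) => //; first exact: coord_continuous.
  by have [_] := gs k.+1; apply.
by apply: IH => j; have [_] := fs j.+1; apply.
Qed.

Lemma smooth_on_comp m n W (U : set 'rV[R]_n) (V : set 'rV[R]_m)
    (f : 'rV[R]_n -> W) (g : 'rV[R]_m -> 'rV[R]_n) :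
  open U -> open V -> g @` V `<=` U ->
  smooth_on U f -> smooth_on V g -> smooth_on V (f \o g).
Proof.
move=> Uo Vo gVU /smooth_onP fs /smooth_onP gs; apply/smooth_onP => k.
by apply: Ck_comp fs gs => // z Vz; apply: gVU; exists z.
Qed.

Lemma smooth_on_eq V W (U : set V) (f g : V -> W) : open U ->
  (forall x, U x -> f x = g x) -> smooth_on U f -> smooth_on U g.
Proof.
by move=> Uo fg /smooth_onP fs; apply/smooth_onP => k; apply: Ck_eq fg (fs k).
Qed.

Lemma smooth_on_cst V W (U : set V) (w : W) : open U ->
  smooth_on U (fun _ : V => w).
Proof. by move=> Uo; apply/smooth_onP => k; exact: Ck_cst. Qed.

Lemma smooth_on_local V W (U : set V) (f : V -> W) :
  (forall x, U x -> exists2 A : set V, A x & smooth_on A f) -> smooth_on U f.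
Proof. by move=> fl s x /fl [A Ax]; apply. Qed.


Lemma smooth_on_add_cst V (U : set V) (u : V) : open U ->
  smooth_on U (fun w : V => u + w).
Proof.
move=> Uo; have du x : is_diff x (fun w : V => u + w) (0 + id : V -> V).
  exact: (@is_diffD _ _ _ (cst u) id).
apply/smooth_onP => -[|k]; split=> // v.
apply: Ck_eq (Ck_cst k v Uo) => // x _.
by rewrite deriveE // diff_val /= add0r.
Qed.

Lemma open_connected_component V (U : set V) (x : V) :
  open U -> open (connected_component U x).
Proof.
move=> Uo; rewrite openE => y xy.
have Uy : U y by exact: connected_component_sub xy.
have /nbhs_ballP[e /= e0 yeU] := open_nbhs_nbhs (conj Uo Uy).
apply/nbhs_ballP; exists e => // z yez.
apply: connected_component_trans xy _.
pose s (t : R) : V := t *: (z - y) + y.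
apply: (@connected_component_max _ U (s @` `[0, 1]) y).
- by exists 0; rewrite /s ?scale0r ?add0r //= in_itv /= lexx ler01.
- move=> _ [t /= /[!in_itv] /= /andP[t0 t1] <-]; apply: yeU; move: yez.
  rewrite -!ball_normE /= /s => yze.
  rewrite opprD addrCA subrr addr0 normrN normrZ ger0_norm // distrC.
  by apply: le_lt_trans yze; rewrite ler_piMl.
- apply: connected_continuous_connected; first exact: segment_connected.
  apply: continuous_subspaceT => t; apply: cvgD; last exact: cvg_cst.
  exact: scalel_continuous.
- by exists 1; rewrite /s ?scale1r ?subrK //= in_itv /= lexx ler01.
Qed.

End smooth.

(* A function on an open set U of R^n is represented by a total function on
   'rV[R]_n of which only the restriction to U matters, see plot_ext. *)
Record diffeology (R : realType) (X : Type) := Diffeology {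
  plot : forall n, set 'rV[R]_n -> ('rV[R]_n -> X) -> Prop ;
  plot_open : forall n (U : set 'rV[R]_n) p, plot U p -> open U ;
  plot_ext : forall n (U : set 'rV[R]_n) p q,
    plot U p -> (forall u, U u -> p u = q u) -> plot U q ;
  plot_cst : forall n (U : set 'rV[R]_n) x, open U -> plot U (fun=> x) ;
  plot_comp : forall n m (U : set 'rV[R]_n) (V : set 'rV[R]_m) p f,
    plot U p -> open V -> smooth_on V f -> f @` V `<=` U -> plot V (p \o f) ;
  plot_cover : forall n (U : set 'rV[R]_n) p (C : set (set 'rV[R]_n)),
    (forall W, C W -> open W) -> \bigcup_(W in C) W = U ->
    (forall W, C W -> plot W p) -> plot U p
}.

Local Obligation Tactic := idtac.

Section diffeologies.
Context {R : realType}.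
Implicit Types X Y : Type.

Lemma diffeologyP X (D E : diffeology R X) :
  (forall n (U : set 'rV[R]_n) p, plot D U p <-> plot E U p) -> D = E.
Proof.
case: D E => [D ? ? ? ? ?] [E ? ? ? ? ?] /= DE.
have {}DE : D = E.
  apply: boolp.functional_extensionality_dep => n.
  apply/funext => U; apply/funext => p.
  exact/propext.
by subst E; congr Diffeology; exact: Prop_irrelevance.
Qed.

Definition smooth X Y (D : diffeology R X) (E : diffeology R Y)
    (f : X -> Y) :=
  forall n (U : set 'rV[R]_n) p, plot D U p -> plot E U (f \o p).

Section euclid.
Variable V : normedModType R.
Let eplot n (U : set 'rV[R]_n) (p : 'rV[R]_n -> V) := open U /\ smooth_on U p.

Program Definition euclid := @Diffeology R V eplot _ _ _ _ _.
Next Obligation. by move=> n U p []. Qed.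
Next Obligation.
by move=> n U p q [Uo ps] pq; split=> //; exact: smooth_on_eq ps.
Qed.
Next Obligation. by move=> n U x Uo; split=> //; exact: smooth_on_cst. Qed.
Next Obligation.
move=> n m U V' p f [Uo ps] Vo fs fVU; split=> //.
exact: (smooth_on_comp Uo Vo fVU ps fs).
Qed.
Next Obligation.
move=> n U p C Co CU Cp; split; first by rewrite -CU; exact: bigcup_open.
apply: smooth_on_local => u; rewrite -CU => -[W CW Wu].
by exists W => //; have [] := Cp _ CW.
Qed.
End euclid.

Section initial.
Variables (X Y : Type) (f : X -> Y) (E : diffeology R Y).

Program Definition initial_diffeology :=
  @Diffeology R X (fun n U p => plot E U (f \o p)) _ _ _ _ _.
Next Obligation. by move=> n U p /plot_open. Qed.
Next Obligation.
by move=> n U p q Ep pq; apply: plot_ext Ep _ => u /pq /= ->.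
Qed.
Next Obligation. by move=> n U x; exact: plot_cst. Qed.
Next Obligation.
by move=> n m U V p g Ep Vo gs gVU; exact: (plot_comp Ep Vo gs gVU).
Qed.
Next Obligation. by move=> n U p C Co CU Cp; exact: (plot_cover Co CU Cp). Qed.
End initial.

Definition sub_diffeology X (A : set X) (D : diffeology R X) :
  diffeology R {x : X | A x} := initial_diffeology (@sval X A) D.

Section product.
Variables (X Y : Type) (D : diffeology R X) (E : diffeology R Y).

Program Definition prod_diffeology := @Diffeology R (X * Y)%type
  (fun n U p => plot D U (fst \o p) /\ plot E U (snd \o p)) _ _ _ _ _.
Next Obligation. by move=> n U p [/plot_open]. Qed.
Next Obligation.
by move=> n U p q [Dp Ep] pq; split; [move: Dp|move: Ep] => /plot_ext;
  apply=> u /pq /= ->.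
Qed.
Next Obligation. by move=> n U x Uo; split; exact: plot_cst. Qed.
Next Obligation.
move=> n m U V p g [Dp Ep] Vo gs gVU; split.
- exact: (plot_comp Dp Vo gs gVU).
- exact: (plot_comp Ep Vo gs gVU).
Qed.
Next Obligation.
by move=> n U p C Co CU Cp; split; apply: (plot_cover Co CU) => W /Cp[].
Qed.
End product.

Section least.
Variables (X : Type) (P : diffeology R X -> Prop).

Program Definition least_diffeology := @Diffeology R X
  (fun n U p => open U /\ forall D, P D -> plot D U p) _ _ _ _ _.
Next Obligation. by move=> n U p []. Qed.
Next Obligation.
by move=> n U p q [Uo Dp] pq; split=> // D /Dp /plot_ext; apply.
Qed.
Next Obligation. by move=> n U x Uo; split=> // D _; exact: plot_cst. Qed.
Next Obligation.
move=> n m U V p g [Uo Dp] Vo gs gVU; split=> // D /Dp {}Dp.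
exact: (plot_comp Dp Vo gs gVU).
Qed.
Next Obligation.
move=> n U p C Co CU Cp; split=> [|D PD].
  by rewrite -CU; exact: bigcup_open.
by apply: (plot_cover Co CU) => W /Cp[_]; apply.
Qed.
End least.

Lemma least_plot X (P : diffeology R X -> Prop) D n (U : set 'rV[R]_n) p :
  P D -> plot (least_diffeology P) U p -> plot D U p.
Proof. by move=> PD [_]; apply. Qed.

Definition finer X (D E : diffeology R X) :=
  forall n (U : set 'rV[R]_n) p, plot D U p -> plot E U p.

End diffeologies.

Section dvs.
Context {R : realType}.

Definition is_dvs (V : lmodType R) (D : diffeology R V) :=
  smooth (prod_diffeology D D) D (fun vw => vw.1 + vw.2) /\
  smooth (prod_diffeology D (euclid R)) D (fun va => va.2 *: va.1).

Definition fine_diffeology (V : lmodType R) : diffeology R V :=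
  least_diffeology (is_dvs (V := V)).

Lemma fine_diffeology_dvs (V : lmodType R) : is_dvs (fine_diffeology V).
Proof.
split=> n U p [p1 p2]; split=> [|E dE]; try exact: plot_open p1.
- have [+ _] := dE; apply; split.
  + exact: least_plot p1.
  + exact: least_plot p2.
- by have [_ +] := dE; apply; split=> //; exact: least_plot p1.
Qed.

Section over.
Context {X : Type} (DX : diffeology R X) (F : X -> lmodType R).

Definition total_space := {x : X & F x}.

Definition fiber_square : set (total_space * total_space) :=
  [set ab | projT1 ab.1 = projT1 ab.2].

Definition fiber_add (w : {ab | fiber_square ab}) : total_space :=
  let: exist ab e := w in
  existT F (projT1 ab.2)
    (eq_rect (projT1 ab.1) (fun y => F y : Type) (projT2 ab.1) _ e
       + projT2 ab.2).

Definition fiber_scale (w : total_space * R) : total_space :=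
  existT F (projT1 w.1) (w.2 *: projT2 w.1).

Definition is_dvs_over (E : diffeology R total_space) :=
  [/\ smooth E DX (@projT1 X F),
      smooth (sub_diffeology fiber_square (prod_diffeology E E)) E
        fiber_add
    & smooth (prod_diffeology E (euclid R)) E fiber_scale].

End over.
End dvs.

Section germ_category.
Context {R : realType} {X : Type} (D : diffeology R X).

Record pointed_plot (x : X) := PointedPlot {
  pdim : nat ;
  pdom : set 'rV[R]_pdim ;
  pfun : 'rV[R]_pdim -> X ;
  pdom_connected : connected pdom ;
  pdom0 : pdom 0 ;
  pfun_plot : plot D pdom pfun ;
  pfun0 : pfun 0 = x
}.

Arguments pdom {x} p _.
Arguments pfun {x} p _.

(* f represents a morphism p --> q; two representatives denote the same
   morphism iff germ_eq. *)
Definition germ_mor (x : X) (p q : pointed_plot x)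
    (f : 'rV[R]_(pdim p) -> 'rV[R]_(pdim q)) :=
  exists W : set 'rV[R]_(pdim p),
    [/\ open W /\ W 0, W `<=` pdom p,
        smooth_on W f /\ f @` W `<=` pdom q, f 0 = 0
      & forall w, W w -> pfun p w = pfun q (f w)].

Definition germ_eq n m (f g : 'rV[R]_n -> 'rV[R]_m) :=
  \forall w \near (0 : 'rV[R]_n), f w = g w.

Definition germ_filtered (x : X) :=
  [/\ exists p : pointed_plot x, True,
      forall p q : pointed_plot x, exists r f g,
        germ_mor (p := p) (q := r) f /\ germ_mor (p := q) (q := r) g
    & forall (p q : pointed_plot x) f g,
        germ_mor (p := p) (q := q) f -> germ_mor (p := p) (q := q) g ->
        exists r h, germ_mor (p := q) (q := r) h /\ germ_eq (h \o f) (h \o g)].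

Definition filtered_space := forall x, germ_filtered x.

End germ_category.

Arguments pdom {R X D x} p _.
Arguments pfun {R X D x} p _.

Section tangent.
Context {R : realType} {X : Type} (D : diffeology R X) (x : X).
Local Notation pplot := (pointed_plot D x).

(* The colimit is the real vector space presented by the generators (p, v)
   with v in T_0(U_p) = R^(pdim p), subject to linearity in v and to
   (p, v) = (q, df_0 v) for every morphism f : p --> q; its universal property
   is itangent_colimit. *)
Inductive tterm : Type :=
| TVec (p : pplot) of 'rV[R]_(pdim p)
| TZero
| TOpp of tterm
| TAdd of tterm & tterm
| TScale of R & tterm.

Inductive teq : tterm -> tterm -> Prop :=
| teq_refl t : teq t t
| teq_sym s t : teq s t -> teq t s
| teq_trans s t r : teq s t -> teq t r -> teq s r
| teq_opp s t : teq s t -> teq (TOpp s) (TOpp t)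
| teq_add s s' t t' : teq s s' -> teq t t' -> teq (TAdd s t) (TAdd s' t')
| teq_scale a s t : teq s t -> teq (TScale a s) (TScale a t)
| teq_addA s t r : teq (TAdd s (TAdd t r)) (TAdd (TAdd s t) r)
| teq_addC s t : teq (TAdd s t) (TAdd t s)
| teq_add0 t : teq (TAdd TZero t) t
| teq_addN t : teq (TAdd (TOpp t) t) TZero
| teq_scaleA a b t : teq (TScale a (TScale b t)) (TScale (a * b) t)
| teq_scale1 t : teq (TScale 1 t) t
| teq_scaleDr a s t : teq (TScale a (TAdd s t)) (TAdd (TScale a s) (TScale a t))
| teq_scaleDl a b t : teq (TScale (a + b) t) (TAdd (TScale a t) (TScale b t))
| teq_lin (p : pplot) a (v w : 'rV[R]_(pdim p)) :
    teq (TVec (a *: v + w)) (TAdd (TScale a (TVec v)) (TVec w))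
| teq_germ (p q : pplot) (f : 'rV[R]_(pdim p) -> 'rV[R]_(pdim q))
    (v : 'rV[R]_(pdim p)) :
    germ_mor f -> teq (TVec v) (TVec ('d f (0 : 'rV[R]_(pdim p)) v)).

HB.instance Definition _ := gen_eqMixin tterm.
HB.instance Definition _ := gen_choiceMixin tterm.

Definition teqb (s t : tterm) : bool := `[< teq s t >].

Lemma teqb_equiv : equiv_class_of teqb.
Proof.
split=> [t|s t|t s r].
- exact/asboolP/teq_refl.
- by apply/idP/idP => /asboolP st; exact/asboolP/teq_sym.
- by move=> /asboolP st /asboolP tr; apply/asboolP; exact: teq_trans tr.
Qed.
Canonical teqb_equiv_rel := EquivRelPack teqb_equiv.

Definition itangent := {eq_quot teqb}%qT.
HB.instance Definition _ := Choice.on itangent.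
HB.instance Definition _ := EqQuotient.on itangent.

Definition tpi (t : tterm) : itangent := \pi_itangent%qT t.

Lemma tpiP s t : tpi s = tpi t <-> teq s t.
Proof. by split=> [/eqmodP/asboolP|st]; last exact/eqmodP/asboolP. Qed.

Lemma tpi_surj (c : itangent) : exists t, c = tpi t.
Proof. by exists (repr c); rewrite /tpi reprK. Qed.

Lemma tpi_repr t : teq (repr (tpi t)) t.
Proof. by apply/tpiP; rewrite /tpi reprK. Qed.

Definition tzero : itangent := tpi TZero.
Definition topp (c : itangent) : itangent := tpi (TOpp (repr c)).
Definition tadd (c d : itangent) : itangent := tpi (TAdd (repr c) (repr d)).
Definition tscale (a : R) (c : itangent) : itangent := tpi (TScale a (repr c)).

Lemma tpi_opp t : topp (tpi t) = tpi (TOpp t).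
Proof. exact/tpiP/teq_opp/tpi_repr. Qed.
Lemma tpi_add s t : tadd (tpi s) (tpi t) = tpi (TAdd s t).
Proof. by apply/tpiP/teq_add; exact: tpi_repr. Qed.
Lemma tpi_scale a t : tscale a (tpi t) = tpi (TScale a t).
Proof. exact/tpiP/teq_scale/tpi_repr. Qed.

Let tpiE := (tpi_opp, tpi_add, tpi_scale).

Lemma taddA : associative tadd.
Proof.
move=> c d e; have [s ->] := tpi_surj c; have [t ->] := tpi_surj d.
have [r ->] := tpi_surj e.
by rewrite !tpiE; exact/tpiP/teq_addA.
Qed.
Lemma taddC : commutative tadd.
Proof.
move=> c d; have [s ->] := tpi_surj c; have [t ->] := tpi_surj d.
by rewrite !tpiE; exact/tpiP/teq_addC.
Qed.
Lemma tadd0 : left_id tzero tadd.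
Proof.
by move=> c; have [s ->] := tpi_surj c; rewrite tpiE; exact/tpiP/teq_add0.
Qed.
Lemma taddN : left_inverse tzero topp tadd.
Proof.
by move=> c; have [s ->] := tpi_surj c; rewrite !tpiE; exact/tpiP/teq_addN.
Qed.
HB.instance Definition _ :=
  GRing.isZmodule.Build itangent taddA taddC tadd0 taddN.

Lemma tscaleA a b c : tscale a (tscale b c) = tscale (a * b) c.
Proof.
by have [s ->] := tpi_surj c; rewrite !tpiE; exact/tpiP/teq_scaleA.
Qed.
Lemma tscale1 : left_id 1 tscale.
Proof.
by move=> c; have [s ->] := tpi_surj c; rewrite !tpiE; exact/tpiP/teq_scale1.
Qed.
Lemma tscaleDr : right_distributive tscale +%R.
Proof.
move=> a c d; have [s ->] := tpi_surj c; have [t ->] := tpi_surj d.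
by rewrite /GRing.add /= !tpiE; exact/tpiP/teq_scaleDr.
Qed.
Lemma tscaleDl c : {morph tscale^~ c : a b / a + b}.
Proof.
move=> a b; have [s ->] := tpi_surj c.
by rewrite {2}/GRing.add /= !tpiE; exact/tpiP/teq_scaleDl.
Qed.
HB.instance Definition _ :=
  GRing.Zmodule_isLmodule.Build R itangent tscaleA tscale1 tscaleDr tscaleDl.

Definition tclass (p : pplot) (v : 'rV[R]_(pdim p)) : itangent := tpi (TVec v).

Lemma tclass_linear (p : pplot) : linear (@tclass p).
Proof.
move=> a v w; rewrite /tclass ((tpiP _ _).2 (teq_lin a v w)).
by rewrite -tpi_add -tpi_scale.
Qed.
HB.instance Definition _ (p : pplot) :=
  GRing.isLinear.Build R 'rV[R]_(pdim p) itangent _ (@tclass p)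
    (@tclass_linear p).

Lemma tclass_germ (p q : pplot) (f : 'rV[R]_(pdim p) -> 'rV[R]_(pdim q)) v :
  germ_mor f -> tclass v = tclass ('d f (0 : 'rV[R]_(pdim p)) v).
Proof. by move=> fpq; exact/tpiP/teq_germ. Qed.

Lemma itangent_colimit (V : lmodType R)
    (c : forall p : pplot, {linear 'rV[R]_(pdim p) -> V}) :
  (forall (p q : pplot) (f : 'rV[R]_(pdim p) -> 'rV[R]_(pdim q)) v,
    germ_mor f -> c p v = c q ('d f (0 : 'rV[R]_(pdim p)) v)) ->
  exists2 h : {linear itangent -> V},
      forall p v, h (@tclass p v) = c p v
    & forall g : {linear itangent -> V},
        (forall p v, g (@tclass p v) = c p v) -> h =1 g.
Proof.
move=> cf.
pose ev := fix ev (t : tterm) : V := match t with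
  | TVec p v => c p v | TZero => 0 | TOpp t => - ev t
  | TAdd s t => ev s + ev t | TScale a t => a *: ev t end.
have evP s t : teq s t -> ev s = ev t.
  elim=> {s t} /=; intros; first [congruence | by rewrite addrA
    | by rewrite addrC | by rewrite add0r | by rewrite addNr
    | by rewrite scalerA | by rewrite scale1r | by rewrite scalerDr
    | by rewrite scalerDl | by rewrite linearP | exact: cf].
pose h0 (k : itangent) : V := ev (repr k).
have h0E t : h0 (tpi t) = ev t by exact/evP/tpi_repr.
have h0_lin : linear h0.
  move=> a k l; have [s ->] := tpi_surj k; have [t ->] := tpi_surj l.
  rewrite (_ : a *: tpi s + tpi t = tpi (TAdd (TScale a s) t)) ?h0E //.
  by rewrite -tpi_add -tpi_scale.
pose hM := GRing.isLinear.Build R itangent V _ h0 h0_lin.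
pose h : {linear itangent -> V} := HB.pack h0 hM.
exists h => [p v|g gE k]; first by rewrite /= h0E.
have [t ->] := tpi_surj k; rewrite /= h0E.
elim: t => [p v||t IH|s IHs t IHt|a t IH] /=.
  - by rewrite -gE.
  - exact: (esym (raddf0 g)).
  - by rewrite IH -tpi_opp -raddfN.
  - by rewrite IHs IHt -tpi_add -raddfD.
  - by rewrite IH -tpi_scale -linearZ.

Qed.

End tangent.

Section tangent_bundle.
Context {R : realType} {X : Type} (D : diffeology R X).

Definition tbundle := total_space (itangent D).

Section translate.
Variables (n : nat) (U : set 'rV[R]_n) (p : 'rV[R]_n -> X).
Hypothesis Up : plot D U p.
Variables (u : 'rV[R]_n) (Uu : U u).

Let V := [set w | U (u + w)].

Lemma translate_open : open V.
Proof.
have /continuousP tc : continuous (fun w : 'rV[R]_n => u + w).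
  move=> w; apply: differentiable_continuous.
  exact: (@differentiableD _ _ _ (cst u) id).
exact: (tc U (plot_open Up)).
Qed.

Lemma translate_dom0 : connected_component V 0 0.
Proof. by apply: connected_component_refl; rewrite /V /= addr0. Qed.

Lemma translate_plot : plot D (connected_component V 0) (p \o (fun w => u + w)).
Proof.
have Co := open_connected_component (0 : 'rV[R]_n) translate_open.
apply: (plot_comp Up Co); first exact: smooth_on_add_cst.
by move=> _ [w /connected_component_sub Vw <-].
Qed.

Lemma translate_pfun0 : (p \o (fun w => u + w)) 0 = p u.
Proof. by rewrite /= addr0. Qed.

(* w |-> p (u + w) on the component of 0 in U - u: pointed plots have a
   connected domain *)
Definition translate : pointed_plot D (p u) :=
  PointedPlot (@component_connected _ V 0) translate_dom0 translate_plot
    translate_pfun0.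

End translate.

(* TU = U * R^n *)
Definition tplot n (U : set 'rV[R]_n) (p : 'rV[R]_n -> X) (Up : plot D U p)
    (a : {uv : 'rV[R]_n * 'rV[R]_n | U uv.1}) : tbundle :=
  existT _ (p (sval a).1) (tclass (p := translate Up (svalP a)) (sval a).2).

Definition hector : diffeology R tbundle :=
  least_diffeology (fun E => forall n (U : set 'rV[R]_n) p (Up : plot D U p),
    smooth
      (sub_diffeology [set uv | U uv.1] (euclid ('rV[R]_n * 'rV[R]_n)%type))
      E (tplot Up)).

Definition tdvs : diffeology R tbundle :=
  least_diffeology (fun E => finer hector E /\ is_dvs_over D E).

Lemma hector_tplot n (U : set 'rV[R]_n) p (Up : plot D U p) :
  smooth
    (sub_diffeology [set uv | U uv.1] (euclid ('rV[R]_n * 'rV[R]_n)%type))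
    hector (tplot Up).
Proof.
move=> m W q Wq; split; first exact: plot_open Wq.
by move=> E; apply.
Qed.

Lemma hector_proj : smooth hector D (@projT1 X (fun y => itangent D y)).
Proof.
pose E := initial_diffeology (@projT1 X (fun y => itangent D y)) D.
move=> n U p; apply: (@least_plot _ _ _ E) => m W q Wq k V a Va.
have [Vo as_] : plot (euclid _) V (sval \o a) := Va.
apply: (plot_comp (f := fst \o (sval \o a)) Wq) => //.
- move/smooth_onP: as_ => as_; apply/smooth_onP => j; apply: Ck_lin => //.
  by move=> z; exact: cvg_fst.
- by move=> _ [z _ <-]; exact: (svalP (a z)).
Qed.

Lemma tdvs_dvs : is_dvs_over D tdvs.
Proof.
split.
- pose E := initial_diffeology (@projT1 X (fun y => itangent D y)) D.
  move=> n U p; apply: (@least_plot _ _ _ E); split.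
    by move=> m V q; exact: hector_proj.
  split=> // m V q.
  + case=> _ qE; apply: (@plot_ext _ _ D _ _ _ _ qE) => z _ /=.
    by case: (q z) => -[a b] e.
  + by case.
- move=> n U p [p1 p2]; split=> [|E [hE dE]]; first exact: plot_open p1.
  have [_ + _] := dE; apply; split.
  + exact: least_plot p1.
  + exact: least_plot p2.
- move=> n U p [p1 p2]; split=> [|E [hE dE]]; first exact: plot_open p1.
  by have [_ _ +] := dE; apply; split=> //; apply: least_plot p1.
Qed.

Definition tfiber (E : diffeology R tbundle) (x : X) :
  diffeology R (itangent D x) :=
  initial_diffeology (fun v => existT (fun y => itangent D y) x v) E.

End tangent_bundle.

(* Main.v *)
Require Import Defs.
From HB Require Import structures.
From mathcomp Require Import all_boot all_order all_algebra.
From mathcomp Require Import all_classical all_reals all_analysis.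
Set Implicit Arguments.
Unset Strict Implicit.
Unset Printing Implicit Defensive.
Import Order.TTheory GRing.Theory Num.Theory.
Import numFieldNormedType.Exports.
Local Open Scope classical_set_scope.
Local Open Scope ring_scope.

(** Write [p, u, v] for the tangent vector represented by v at the point u of
    a plot p.  A plot of Hector's diffeology is, locally, either constant or a
    lift w |-> [p, g w, v w] of smooth data (g, v) through a plot p of X.  When
    X is filtered every tangent vector is represented by a single [p, u, v],
    so the constants are lifts too (tclass_surj, hector_lifts).

    A factorization p = q \o f near u transports lifts: [p, u, v] equals
    [q, f u, df_u v], at u and at every nearby point (tplot_factors,
    lift_factors).  The two halves of filteredness, moved from base point 0 to
    arbitrary points of plots, then give the following.
    - If p u = q v, then p and q factor near u and v through a common plot
      (common_refinement).
    - If f and g are smooth with q \o f = q \o g and f w0 = g w0, then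
      q = r \o h near f w0 for some plot r with h \o f = h \o g near w0
      (coequalizing_refinement).

    Fiberwise addition: two lifts over the same map to X are first transported
    to a common plot r; their base maps a and b then satisfy r \o a = r \o b and
    agree at the chosen point, because both germs are pointed.  Coequalizing a
    and b makes the base maps equal (common_lift), and lifts with the same base
    map are added in the vector component.  Scalar multiplication acts on the
    vector component alone.  Hence Hector's diffeology already is one of a
    diffeological vector space over X, and equals the least such one above it.

    Fibers: a lift that stays in T_x(X) has a base map g with p \o g constant.
    Coequalizing g with the constant map g w0 makes the base map constant, and
    the lift becomes v followed by a fixed linear map from some R^k to T_x(X).
    Such a map is a plot of every vector space diffeology on T_x(X)
    (dvs_linear_plot), so it is a plot of the fine one. *)

(** * Smooth maps between normed spaces *)

Section smooth_maps.
Context {R : realType}.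
Implicit Types V W : normedModType R.

Lemma smooth_onS V W (A B : set V) (f : V -> W) :
  A `<=` B -> smooth_on B f -> smooth_on A f.
Proof. by move=> AB fB s x /AB; exact: fB. Qed.

Lemma smooth_on_diff V W (A : set V) (f : V -> W) x :
  smooth_on A f -> A x -> differentiable f x.
Proof. by move=> fA; exact: (fA [::]). Qed.

Lemma smooth_on_cvg V W (A : set V) (f : V -> W) x :
  smooth_on A f -> A x -> {for x, continuous f}.
Proof.
by move=> fA Ax; apply: differentiable_continuous; exact: smooth_on_diff Ax.
Qed.

Lemma smooth_on_derive V W (A : set V) (f : V -> W) v :
  smooth_on A f -> smooth_on A ('D_v f).
Proof. by move=> fA s; exact: (fA (v :: s)). Qed.

Lemma open_smooth_preimage V W (A : set V) (B : set W) (f : V -> W) :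
  open A -> open B -> smooth_on A f -> open (A `&` f @^-1` B).
Proof.
move=> Ao Bo fA; rewrite openE => x [Ax Bfx]; apply: filterI.
  exact: open_nbhs_nbhs.
by apply: (smooth_on_cvg fA Ax); exact: open_nbhs_nbhs.
Qed.

Lemma smooth_on_id V (A : set V) : open A -> smooth_on A (fun x => x).
Proof.
move=> Ao; have := smooth_on_add_cst 0 Ao.
by apply: smooth_on_eq => // x _; rewrite add0r.
Qed.

Lemma smooth_on_pair V W W' (A : set V) (f : V -> W) (g : V -> W') : open A ->
  smooth_on A f -> smooth_on A g -> smooth_on A (fun x => (f x, g x)).
Proof.
move=> Ao /smooth_onP fA /smooth_onP gA; apply/smooth_onP => k.
have dfg (f' : V -> W) (g' : V -> W') x : (forall j, Ck j A f') ->
    (forall j, Ck j A g') -> A x -> differentiable (fun x => (f' x, g' x)) x.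
  move=> f'A g'A Ax; apply: differentiable_pair.
  - exact: Ck_diff (f'A 0%N) Ax.
  - exact: Ck_diff (g'A 0%N) Ax.
elim: k f g fA gA => [|k IH] f g fA gA; split=> //.
- by move=> x; exact: dfg.
- by move=> x; exact: dfg.
move=> v; apply: Ck_eq (IH ('D_v f) ('D_v g) _ _) => //.
- move=> x Ax.
  have df := Ck_diff (fA 0%N) Ax; have dg := Ck_diff (gA 0%N) Ax.
  by rewrite !deriveE ?diff_pair //; exact: dfg.
- by move=> j; have [_] := fA j.+1; apply.
- by move=> j; have [_] := gA j.+1; apply.
Qed.

Lemma smooth_on_linear V V' W (A : set V) (l : {linear V' -> W})
    (f : V -> V') :
  open A -> continuous l -> smooth_on A f -> smooth_on A (l \o f).
Proof.
by move=> Ao lc /smooth_onP fA; apply/smooth_onP => k; exact: Ck_lin.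
Qed.

Lemma smooth_on_sum V W (A : set V) n (f : 'I_n -> V -> W) : open A ->
  (forall i, smooth_on A (f i)) -> smooth_on A (fun x => \sum_(i < n) f i x).
Proof.
move=> Ao fA; apply: (@smooth_on_eq _ _ _ _ (\sum_(i < n) f i)) => //.
  by move=> x _; rewrite fct_sumE.
by apply/smooth_onP => k; apply: Ck_sum => // i; have /smooth_onP := fA i.
Qed.

Lemma smooth_on_add V W (A : set V) (f g : V -> W) : open A ->
  smooth_on A f -> smooth_on A g -> smooth_on A (fun x => f x + g x).
Proof.
move=> Ao fA gA; pose F (i : 'I_2) := if i == ord0 then f else g.
apply: smooth_on_eq (smooth_on_sum (f := F) Ao _) => //.
  by move=> x _; rewrite big_ord_recl big_ord1.
by move=> i; rewrite /F; case: ifP.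
Qed.

Lemma smooth_on_scale V W (A : set V) (a : V -> R) (f : V -> W) : open A ->
  smooth_on A a -> smooth_on A f -> smooth_on A (fun x => a x *: f x).
Proof.
move=> Ao /smooth_onP aA /smooth_onP fA; apply/smooth_onP => k.
exact: Ck_scaling.
Qed.

Lemma smooth_on_coord V n (A : set V) (f : V -> 'rV[R]_n) i : open A ->
  smooth_on A f -> smooth_on A (fun x => f x 0 i).
Proof.
move=> Ao fA.
have l_lin : linear (fun N : 'rV[R]_n => N 0 i).
  by move=> a M N; rewrite !mxE.
pose lM := GRing.isLinear.Build R 'rV[R]_n R _ _ l_lin.
pose l : {linear 'rV[R]_n -> R} := HB.pack (fun N : 'rV[R]_n => N 0 i) lM.
by apply: (smooth_on_linear (l := l) Ao _ fA); exact: coord_continuous.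
Qed.

(** The tangent map of f along smooth data (g, v).  In coordinates it is
    the sum of the v_i times the i-th partial derivative of f along g, which
    is smooth termwise. *)
Lemma smooth_on_tangent m n W (A : set 'rV[R]_m) (B : set 'rV[R]_n)
    (f : 'rV[R]_n -> W) (g v : 'rV[R]_m -> 'rV[R]_n) :
  open A -> open B -> g @` A `<=` B ->
  smooth_on B f -> smooth_on A g -> smooth_on A v ->
  smooth_on A (fun w => 'd f (g w) (v w)).
Proof.
move=> Ao Bo gAB fB gA vA.
pose e i : 'rV[R]_n := delta_mx 0 i.
pose F i w := v w 0 i *: ('D_(e i) f \o g) w.
apply: (smooth_on_eq (f := fun w => \sum_(i < n) F i w)) => //.
  move=> w Aw.
  have df := smooth_on_diff fB (gAB _ (ex_intro2 _ _ _ Aw erefl)).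
  rewrite (row_sum_delta (v w)) linear_sum; apply: eq_bigr => i _ /=.
  rewrite /F /= (deriveE (e i) df); exact: (esym (linearZ _ _)).
apply: (smooth_on_sum (f := F)) => // i.
apply: smooth_on_scale => //; first exact: smooth_on_coord.
by apply: (smooth_on_comp Bo Ao gAB _ gA); exact: smooth_on_derive.
Qed.

(** Stated for directional derivatives because their difference quotients are
    literally the same on both sides. *)
Lemma derive_translate V W (f : V -> W) (u : V) (b : W) v :
  'D_v (fun w => f (u + w) - b) 0 = 'D_v f u.
Proof.
rewrite /derive; set F := (F in lim (F @ _) = _).
set G := (G in _ = lim (G @ _)); suff -> : F = G by [].
apply/funext => h; rewrite /F /G /=.
rewrite !addr0 [h *: v + u]addrC.
by rewrite opprB addrA subrK.
Qed.

Lemma open_translate n (A : set 'rV[R]_n) u :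
  open A -> open [set w | A (u + w)].
Proof.
move=> Ao.
have := open_smooth_preimage openT Ao (smooth_on_add_cst u openT).
by rewrite setTI.
Qed.

End smooth_maps.

(** * Plots are local, and linear maps are plots of vector spaces *)

Section plots.
Context {R : realType}.

Lemma plot_local (X : Type) (E : diffeology R X) m (W : set 'rV[R]_m) P :
  (forall w, W w -> exists W', [/\ W' w, W' `<=` W & plot E W' P]) ->
  plot E W P.
Proof.
move=> PW; pose C := [set W' | W' `<=` W /\ plot E W' P].
apply: (@plot_cover _ _ _ _ _ _ C).
- by move=> W' [_ /plot_open].
- apply/seteqP; split=> [w [W' [W'W _] /W'W]//|w Ww].
  by have [W' [W'w W'W PW']] := PW w Ww; exists W'.
- by move=> W' [].
Qed.

(** In coordinates l (v w) is a finite sum of smooth scalars times fixed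
    vectors, hence built from constants by the two smooth operations. *)
Lemma dvs_linear_plot (V : lmodType R) (E : diffeology R V) m
    (W : set 'rV[R]_m) k (l : {linear 'rV[R]_k -> V})
    (v : 'rV[R]_m -> 'rV[R]_k) :
  is_dvs E -> open W -> smooth_on W v -> plot E W (l \o v).
Proof.
move=> [addE scaleE] Wo vW.
have sumE (s : seq 'I_k) :
    plot E W (fun w => \sum_(i <- s) v w 0 i *: l (delta_mx 0 i)).
  elim: s => [|i s IH].
    by apply: plot_ext (plot_cst E 0 Wo) _ => w _; rewrite big_nil.
  pose a w := (v w 0 i *: l (delta_mx 0 i),
               \sum_(j <- s) v w 0 j *: l (delta_mx 0 j)).
  apply: plot_ext (addE _ _ a _) _ => [|w _]; last by rewrite big_cons.
  split=> //.
  apply: (scaleE _ _ (fun w => (l (delta_mx 0 i), v w 0 i))); split.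
    exact: plot_cst.
  by split=> //; exact: smooth_on_coord.
apply: plot_ext (sumE (index_enum _)) _ => w _ /=.
rewrite {2}(row_sum_delta (v w)) linear_sum; apply: eq_bigr => i _ /=.
exact: (esym (linearZ _ _)).
Qed.

End plots.

(** * Local factorizations of plots *)

Section factorizations.
Context {R : realType} {X : Type} (D : diffeology R X).

(** A representative of a germ of the category of plots, without its base
    point: the same f represents a germ at each point of its domain A. *)
Definition factors n m (U : set 'rV[R]_n) (p : 'rV[R]_n -> X)
    (V : set 'rV[R]_m) (q : 'rV[R]_m -> X) (A : set 'rV[R]_n)
    (f : 'rV[R]_n -> 'rV[R]_m) :=
  [/\ open A, A `<=` U, smooth_on A f, f @` A `<=` V
    & forall u, A u -> p u = q (f u)].

Lemma factors_germ_mor x (P Q : pointed_plot D x) A f :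
  factors (pdom P) (pfun P) (pdom Q) (pfun Q) A f -> A 0 -> f 0 = 0 ->
  germ_mor (p := P) (q := Q) f.
Proof. by move=> [Ao AU fA fAV pq] A0 f0; exists A. Qed.

Lemma germ_mor_factors x (P Q : pointed_plot D x) f :
  germ_mor (p := P) (q := Q) f ->
  f 0 = 0 /\
  exists2 A, A 0 & factors (pdom P) (pfun P) (pdom Q) (pfun Q) A f.
Proof. by move=> [A [[Ao A0] AU [fA fAV] f0 pq]]; split=> //; exists A. Qed.

Lemma factors_translate n m (U : set 'rV[R]_n) p (V : set 'rV[R]_m) q A f u b
    (Up : plot D U p) (Vq : plot D V q) (Uu : U u) (Vb : V b) :
  factors U p V q A f -> A u -> f u = b ->
  exists2 A', A' 0 &
    factors (pdom (translate Up Uu)) (pfun (translate Up Uu))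
      (pdom (translate Vq Vb)) (pfun (translate Vq Vb))
      A' (fun w => f (u + w) - b).
Proof.
move=> [Ao AU fA fAV pq] Au fub.
pose B := [set w | A (u + w)]; have Bo : open B by exact: open_translate.
have B0 : B 0 by rewrite /B /= addr0.
have Cs : connected_component B 0 `<=` B by exact: connected_component_sub.
have Co := open_connected_component (0 : 'rV[R]_n) Bo.
have C0 : connected_component B 0 0 by exact: connected_component_refl.
have fC : smooth_on (connected_component B 0) (fun w => f (u + w) - b).
  apply: smooth_on_add => //; last exact: smooth_on_cst.
  apply: (smooth_on_comp Ao Co _ fA); last exact: smooth_on_add_cst.
  by move=> _ [w /Cs Bw <-].
(* A connected domain is needed: its image must stay in the component of 0
   that is the domain of the translated plot. *)
exists (connected_component B 0) => //; split=> //=.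
- apply: connected_component_max => //.
  + by move=> w /Cs /AU.
  + exact: component_connected.
- apply: (@connected_component_max 'rV[R]_m _ _ (0 : 'rV[R]_m)).
  + by exists 0 => //; rewrite addr0 fub subrr.
  + move=> _ [w /Cs Bw <-] /=; rewrite [b + _]addrC subrK.
    by apply: fAV; exists (u + w).
  + apply: connected_continuous_connected; first exact: component_connected.
    apply: continuous_in_subspaceT => w; rewrite inE => Cw.
    exact: smooth_on_cvg fC Cw.
- by move=> w /Cs /pq ->; rewrite [b + _]addrC subrK.
Qed.

Lemma translate_factors n m (U : set 'rV[R]_n) p (Z : set 'rV[R]_m) r
    (A : set 'rV[R]_n) (f : 'rV[R]_n -> 'rV[R]_m) u
    (Up : plot D U p) (Uu : U u) :
  factors (pdom (translate Up Uu)) (pfun (translate Up Uu)) Z r A f -> A 0 ->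
  exists2 A', A' u & factors U p Z r A' (fun w => f (- u + w)).
Proof.
move=> [Ao AU fA fAV pq] A0; pose B := [set w | A (- u + w)].
have Bo : open B by exact: open_translate.
exists B; first by rewrite /B /= addNr.
split=> //.
- by move=> w /AU /connected_component_sub /=; rewrite addrA subrr add0r.
- apply: (smooth_on_comp Ao Bo _ fA); last exact: smooth_on_add_cst.
  by move=> _ [w Bw <-].
- by move=> _ [w Bw <-]; apply: fAV; exists (- u + w).
- by move=> w /pq <- /=; rewrite addrA subrr add0r.
Qed.

(** The base points x and y are kept apart because two translated plots have
    base points p u and q v that are only provably equal. *)
Lemma filtered_bound x y (P : pointed_plot D x) (Q : pointed_plot D y) :
  germ_filtered D y -> x = y -> exists (r : pointed_plot D y) A f B g,
    [/\ factors (pdom P) (pfun P) (pdom r) (pfun r) A f, A 0 /\ f 0 = 0,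
        factors (pdom Q) (pfun Q) (pdom r) (pfun r) B g & B 0 /\ g 0 = 0].
Proof.
move=> [_ bound _] xy; subst y; have [r [f [g [fm gm]]]] := bound P Q.
have [f0 [A A0 fA]] := germ_mor_factors fm.
have [g0 [B B0 gB]] := germ_mor_factors gm.
by exists r, A, f, B, g.
Qed.

Hypothesis hX : filtered_space D.

Lemma common_refinement n m (U : set 'rV[R]_n) p (V : set 'rV[R]_m) q u v :
  plot D U p -> plot D V q -> U u -> V v -> p u = q v ->
  exists k (Z : set 'rV[R]_k) r A f B g,
    [/\ plot D Z r, factors U p Z r A f /\ A u, factors V q Z r B g /\ B v
      & f u = g v].
Proof.
move=> Up Vq Uu Vv pq.
have [r [A [f [B [g [fA [A0 f0] gB [B0 g0]]]]]]] :=
  filtered_bound (translate Up Uu) (translate Vq Vv) (hX _) pq.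
have [A' A'u fA'] := translate_factors fA A0.
have [B' B'v gB'] := translate_factors gB B0.
exists (pdim r), (pdom r), (pfun r), A', (fun w => f (- u + w)), B',
  (fun w => g (- v + w)).
by split=> //; [exact: pfun_plot|rewrite !addNr f0 g0].
Qed.

(** The maps f and g, translated by w0 and by their common value, are parallel
    germs from the pointed plot q \o f at w0 to the pointed plot q at f w0. *)
Lemma coequalizing_refinement m n (W : set 'rV[R]_m) (V : set 'rV[R]_n) q f g
    w0 :
  plot D V q -> open W -> W w0 -> smooth_on W f -> smooth_on W g ->
  f @` W `<=` V -> g @` W `<=` V -> (forall w, W w -> q (f w) = q (g w)) ->
  f w0 = g w0 ->
  exists k (Z : set 'rV[R]_k) r B h C,
    [/\ plot D Z r, factors V q Z r B h /\ B (f w0), open C /\ C w0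
      & C `<=` [set w | h (f w) = h (g w)]].
Proof.
move=> Vq Wo Ww0 fW gW fWV gWV qfg fg0.
have Wqf : plot D W (q \o f) by exact: (plot_comp Vq Wo fW fWV).
have Vfw0 : V (f w0) by apply: fWV; exists w0.
have [_ _ coeq] := hX (q (f w0)).
have fF : factors W (q \o f) V q W f by split.
have gF : factors W (q \o f) V q W g by split.
have [A A0 fA] := factors_translate Wqf Vq Ww0 Vfw0 fF Ww0 erefl.
have [B B0 gB] := factors_translate Wqf Vq Ww0 Vfw0 gF Ww0 (esym fg0).
have [||r [h [hm hfg]]] := coeq (translate Wqf Ww0) (translate Vq Vfw0) _ _
  (factors_germ_mor fA A0 _) (factors_germ_mor gB B0 _).
- by rewrite addr0 subrr.
- by rewrite addr0 -fg0 subrr.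
have [h0 [E E0 hE]] := germ_mor_factors hm.
have [E' E'b hE'] := translate_factors hE E0.
move: hfg; rewrite /germ_eq -nbhs_nearE nbhsE => -[N [No N0] Nh].
exists (pdim r), (pdom r), (pfun r), E', (fun w => h (- f w0 + w)),
  [set w | N (- w0 + w)].
split=> //; first exact: pfun_plot.
- by split; [exact: open_translate|rewrite /= addNr].
- move=> w /Nh /=; rewrite addrA subrr add0r.
  by rewrite [f w + _]addrC [g w + _]addrC.
Qed.

End factorizations.

(** * Lifts to the tangent bundle *)

Section lifts.
Context {R : realType} {X : Type} (D : diffeology R X).

Lemma existT_inj (I : Type) (F : I -> Type) i (a b : F i) :
  existT F i a = existT F i b -> a = b.
Proof.
move=> ab; move: (projT2_eq ab); move: (projT1_eq ab) => /= e.
by rewrite (Prop_irrelevance e erefl).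
Qed.

Lemma tbundle_germ x y (P : pointed_plot D x) (Q : pointed_plot D y) A f v :
  x = y -> factors (pdom P) (pfun P) (pdom Q) (pfun Q) A f -> A 0 -> f 0 = 0 ->
  existT (itangent D) x (tclass v) =
  existT (itangent D) y (tclass (p := Q) ('D_v f (0 : 'rV[R]_(pdim P)))).
Proof.
move=> xy; subst y => fA A0 f0; congr existT.
rewrite (tclass_germ v (factors_germ_mor fA A0 f0)) deriveE //.
by case: fA => _ _ fA _ _; exact: smooth_on_diff A0.
Qed.

Lemma tplotE n (U : set 'rV[R]_n) p (Up : plot D U p) u v (Uu : U u) :
  tplot Up (exist _ (u, v) Uu) =
  existT (itangent D) (p u) (tclass (p := translate Up Uu) v).
Proof.
(* tplot uses svalP for the proof of U u, which is opaque *)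
suff E (Vu : U u) :
    existT (itangent D) (p u) (tclass (p := translate Up Vu) v) =
    existT (itangent D) (p u) (tclass (p := translate Up Uu) v) by exact: E.
by rewrite (Prop_irrelevance Vu Uu).
Qed.

Lemma tplot_factors n m (U : set 'rV[R]_n) p (V : set 'rV[R]_m) q A f u v b
    (Up : plot D U p) (Vq : plot D V q) (Uu : U u) (Vb : V b) :
  factors U p V q A f -> A u -> f u = b ->
  tplot Up (exist _ (u, v) Uu) = tplot Vq (exist _ (b, 'd f u v) Vb).
Proof.
move=> fA Au fub; have [A' A'0 fA'] := factors_translate Up Vq Uu Vb fA Au fub.
have [_ _ fs _ pq] := fA; rewrite -deriveE; last exact: smooth_on_diff Au.
rewrite !tplotE -(derive_translate f u b v).
by apply: (@tbundle_germ _ _ (translate Up Uu) (translate Vq Vb) A' _ v _ fA'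
  A'0); [rewrite -fub pq|rewrite addr0 fub subrr].
Qed.

(** The translate of P by 0 is P restricted to the component of 0 - the same
    germ but not the same pointed plot. *)
Lemma tclass_tplot x (P : pointed_plot D x) v :
  existT (itangent D) x (tclass v) =
  tplot (pfun_plot P) (exist _ (0, v) (pdom0 P)).
Proof.
set T := translate (pfun_plot P) (pdom0 P).
have To : open (pdom T) by exact: plot_open (pfun_plot T).
have fT : factors (pdom T) (pfun T) (pdom P) (pfun P) (pdom T) (fun w => w).
  split=> //; first exact: smooth_on_id.
  - move=> _ [w Tw <-]; have := connected_component_sub Tw.
    by rewrite /mkset /= [X in pdom P X -> _]add0r.
  - by move=> w _ /=; rewrite add0r.
rewrite tplotE -/T.
have := @tbundle_germ _ _ T P _ _ v (pfun0 P) fT (pdom0 T) erefl.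
by rewrite derive_id.
Qed.

Definition is_lift m (W : set 'rV[R]_m) (P : 'rV[R]_m -> tbundle D)
    n (U : set 'rV[R]_n) p (Up : plot D U p) (g v : 'rV[R]_m -> 'rV[R]_n) :=
  [/\ open W, smooth_on W g, smooth_on W v
    & forall w, W w ->
        exists Uu : U (g w), P w = tplot Up (exist _ (g w, v w) Uu)].

Definition locally_lifts m (W : set 'rV[R]_m) (P : 'rV[R]_m -> tbundle D) :=
  forall w0, W w0 -> exists W' n (U : set 'rV[R]_n) p (Up : plot D U p) g v,
    W' w0 /\ is_lift W' P Up g v.

Lemma lift_image m (W : set 'rV[R]_m) P n (U : set 'rV[R]_n) p
    (Up : plot D U p) g v :
  is_lift W P Up g v -> g @` W `<=` U.
Proof. by move=> [_ _ _ PW] _ [w /PW [Uu _] <-]. Qed.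

Lemma lift_proj m (W : set 'rV[R]_m) P n (U : set 'rV[R]_n) p
    (Up : plot D U p) g v w :
  is_lift W P Up g v -> W w -> projT1 (P w) = p (g w).
Proof. by move=> [_ _ _ PW] /PW [Uu ->]. Qed.

Lemma liftS m (W W' : set 'rV[R]_m) P n (U : set 'rV[R]_n) p
    (Up : plot D U p) g v :
  open W' -> W' `<=` W -> is_lift W P Up g v -> is_lift W' P Up g v.
Proof.
move=> W'o W'W [Wo gW vW PW]; split=> //.
- exact: smooth_onS gW.
- exact: smooth_onS vW.
- by move=> w /W'W /PW.
Qed.

Lemma lift_eq m (W : set 'rV[R]_m) P P' n (U : set 'rV[R]_n) p
    (Up : plot D U p) g g' v :
  (forall w, W w -> P w = P' w) -> (forall w, W w -> g w = g' w) ->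
  is_lift W P Up g v -> is_lift W P' Up g' v.
Proof.
move=> PP' gg' [Wo gW vW PW]; split=> //; first exact: smooth_on_eq gW.
by move=> w Ww; rewrite -(PP' w Ww) -(gg' w Ww); exact: PW.
Qed.

Lemma lift_factors m (W : set 'rV[R]_m) P n (U : set 'rV[R]_n) p
    (Up : plot D U p) g v k (Z : set 'rV[R]_k) r (Zr : plot D Z r) A f :
  is_lift W P Up g v -> factors U p Z r A f ->
  is_lift (W `&` g @^-1` A) P Zr (f \o g) (fun w => 'd f (g w) (v w)).
Proof.
move=> [Wo gW vW PW] fA; have [Ao AU fs fAZ pr] := fA.
have Io := open_smooth_preimage Wo Ao gW.
have IW : W `&` g @^-1` A `<=` W by move=> w [].
have gIA : g @` (W `&` g @^-1` A) `<=` A by move=> _ [w [_ Agw] <-].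
have gI := smooth_onS IW gW; have vI := smooth_onS IW vW.
split=> //.
- exact: (smooth_on_comp Ao Io gIA fs gI).
- exact: (smooth_on_tangent Io Ao gIA fs gI vI).
- move=> w [Ww Agw]; have [Uu ->] := PW w Ww.
  have Zfgw : Z (f (g w)) by apply: fAZ; exists (g w).
  by exists Zfgw; exact: (tplot_factors _ Up Zr Uu Zfgw fA Agw erefl).
Qed.

Lemma lift_hector m (W : set 'rV[R]_m) P n (U : set 'rV[R]_n) p
    (Up : plot D U p) g v w0 :
  W w0 -> is_lift W P Up g v -> plot (hector D) W P.
Proof.
move=> Ww0 [Wo gW vW PW]; have [Uu0 _] := PW w0 Ww0.
(* Plots are total functions: outside W the value at w0 is a default. *)
have /choice [a aE] : forall w,
    exists z : {uv : 'rV[R]_n * 'rV[R]_n | U uv.1}, W w -> sval z = (g w, v w).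
  move=> w; have [Ww|Ww] := pselect (W w).
    by have [Uu _] := PW w Ww; exists (exist _ (g w, v w) Uu).
  by exists (exist _ (g w0, v w0) Uu0).
have Wa : plot (sub_diffeology [set uv | U uv.1]
    (euclid ('rV[R]_n * 'rV[R]_n)%type)) W a.
  split=> //; apply: smooth_on_eq (smooth_on_pair Wo gW vW) => // w Ww /=.
  by rewrite aE.
apply: plot_ext (hector_tplot Up Wa) _ => w Ww /=.
have [Uu ->] := PW w Ww; congr tplot.
case: (a w) (aE w Ww) => z Uz /= zE; subst z.
by rewrite (Prop_irrelevance Uz Uu).
Qed.

Lemma locally_lifts_hector m (W : set 'rV[R]_m) P :
  open W -> locally_lifts W P -> plot (hector D) W P.
Proof.
move=> Wo PW; apply: plot_local => w Ww.
have [W' [n [U [p [Up [g [v [W'w PW']]]]]]]] := PW w Ww.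
have W'o : open W' by case: PW'.
have IW' : W' `&` W `<=` W' by move=> ? [].
exists (W' `&` W); split=> //.
exact: (lift_hector (conj W'w Ww) (liftS (openI W'o Wo) IW' PW')).
Qed.

Lemma lift_scale m (W : set 'rV[R]_m) (P : 'rV[R]_m -> tbundle D)
    n (U : set 'rV[R]_n) p (Up : plot D U p) g v (a : 'rV[R]_m -> R) :
  smooth_on W a -> is_lift W P Up g v ->
  is_lift W (fun w => fiber_scale (P w, a w)) Up g (fun w => a w *: v w).
Proof.
move=> aW [Wo gW vW PW]; split=> //; first exact: smooth_on_scale.
move=> w /PW [Uu ->]; exists Uu.
by rewrite !tplotE /fiber_scale /= linearZ.
Qed.

Lemma fiber_addE x (a b : itangent D x)
    (z : {ab | fiber_square (F := itangent D) ab}) :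
  (sval z).1 = existT _ x a -> (sval z).2 = existT _ x b ->
  fiber_add z = existT _ x (a + b).
Proof.
case: z => -[a' b'] e /= ea eb; subst a' b'; rewrite /fiber_add /=.
by rewrite (Prop_irrelevance e erefl).
Qed.

Lemma lift_add m (W : set 'rV[R]_m)
    (P : 'rV[R]_m -> {ab | fiber_square (F := itangent D) ab})
    n (U : set 'rV[R]_n) p (Up : plot D U p) g v v' :
  is_lift W (fst \o (sval \o P)) Up g v ->
  is_lift W (snd \o (sval \o P)) Up g v' ->
  is_lift W (fun w => fiber_add (P w)) Up g (fun w => v w + v' w).
Proof.
move=> [Wo gW vW PW] [_ _ vW' PW']; split=> //; first exact: smooth_on_add.
move=> w Ww; have [Uu /= P1] := PW w Ww; have [Uu' /= P2] := PW' w Ww.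
exists Uu; move: P1 P2; rewrite (Prop_irrelevance Uu' Uu) !tplotE => P1 P2.
by rewrite (fiber_addE P1 P2) linearD.
Qed.

(** Once the representing pointed plot Q is fixed, a curve of tangent vectors
    at x is the image of a smooth curve in some R^k under a linear map. *)
Lemma fiber_linear x y (Q : pointed_plot D y) m (W : set 'rV[R]_m) w0
    (P : 'rV[R]_m -> itangent D x) (v : 'rV[R]_m -> 'rV[R]_(pdim Q)) :
  open W -> W w0 -> smooth_on W v ->
  (forall w, W w -> existT (itangent D) x (P w) = existT _ y (tclass (v w))) ->
  plot (fine_diffeology (itangent D x)) W P.
Proof.
move=> Wo Ww0 vW PE; have xy : x = y := congr1 (@projT1 _ _) (PE w0 Ww0).
subst y.
apply: plot_ext (dvs_linear_plot (@tclass _ _ _ _ Q)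
  (fine_diffeology_dvs _) Wo vW) _ => w Ww /=.
exact: esym (existT_inj (PE w Ww)).
Qed.

End lifts.

(** * Hector's diffeology on a filtered space *)

Section filtered.
Context {R : realType} {X : Type} (D : diffeology R X).
Hypothesis hX : filtered_space D.

(** A sum of classes is a single class because two pointed plots have a common
    bound in the germ category, where their vectors can be added. *)
Lemma tclass_surj x (c : itangent D x) :
  exists (P : pointed_plot D x) v, c = tclass (p := P) v.
Proof.
have [t ->] := tpi_surj c; have [[P0 _] bound _] := hX x.
elim: t => [P v||t [P [v IH]]|s [P [v IHs]] t [Q [u IHt]]|a t [P [v IH]]].
- by exists P, v.
- by exists P0, 0; exact: (esym (raddf0 (@tclass _ _ _ _ P0))).
- exists P, (- v); rewrite -tpi_opp IH.
  exact: (esym (raddfN (@tclass _ _ _ _ P) v)).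
- have [r [f [g [fr gr]]]] := bound P Q.
  exists r, ('d f (0 : 'rV[R]_(pdim P)) v + 'd g (0 : 'rV[R]_(pdim Q)) u).
  rewrite -tpi_add IHs IHt (tclass_germ v fr) (tclass_germ u gr).
  exact: (esym (raddfD (@tclass _ _ _ _ r) _ _)).
- exists P, (a *: v); rewrite -tpi_scale IH.
  by rewrite linearZ.
Qed.

Local Obligation Tactic := idtac.

(** Hector's diffeology is given as a least one, so a description of all its
    plots amounts to a diffeology with the described plots.  Filteredness
    enters through the constant plots. *)
Program Definition lift_diffeology := @Diffeology R (tbundle D)
  (fun m W P => open W /\ locally_lifts W P) _ _ _ _ _.
Next Obligation. by move=> m W P []. Qed.
Next Obligation.
move=> m W P Q [Wo PW] PQ; split=> // w0 Ww0.
have [W' [n [U [p [Up [g [v [W'w PW']]]]]]]] := PW w0 Ww0.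
have W'o : open W' by case: PW'.
have IW' : W' `&` W `<=` W' by move=> ? [].
exists (W' `&` W), n, U, p, Up, g, v; split=> //.
by apply: lift_eq (liftS (openI W'o Wo) IW' PW') => // w [_ /PQ].
Qed.
Next Obligation.
move=> m W [x c] Wo; split=> // w0 Ww0.
have [P [v ->]] := tclass_surj c.
exists W, (pdim P), (pdom P), (pfun P), (pfun_plot P), (fun=> 0), (fun=> v).
split=> //; split=> //; try exact: smooth_on_cst.
by move=> w _; exists (pdom0 P); exact: tclass_tplot.
Qed.
Next Obligation.
move=> m k W V P f [Wo PW] Vo fV fVW; split=> // v0 Vv0.
have [|W' [n [U [p [Up [g [v [W'w PW']]]]]]]] := PW (f v0).
  by apply: fVW; exists v0.
have [W'o gW' vW' PE] := PW'.
have Io := open_smooth_preimage Vo W'o fV.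
have fI : smooth_on (V `&` f @^-1` W') f by apply: smooth_onS fV => ? [].
have fIW' : f @` (V `&` f @^-1` W') `<=` W' by move=> _ [w [_ ?] <-].
exists (V `&` f @^-1` W'), n, U, p, Up, (g \o f), (v \o f); split=> //.
split=> //.
- exact: (smooth_on_comp W'o Io fIW' gW' fI).
- exact: (smooth_on_comp W'o Io fIW' vW' fI).
- by move=> w [_ /PE].
Qed.
Next Obligation.
move=> m W P C Co CW CP; split; first by rewrite -CW; exact: bigcup_open.
by move=> w0; rewrite -CW => -[W' CW' W'w0]; have [_] := CP _ CW'; apply.
Qed.

Lemma hector_lifts m (W : set 'rV[R]_m) P :
  plot (hector D) W P -> locally_lifts W P.
Proof.
move=> PW; suff liftP : plot lift_diffeology W P by case: liftP.
apply: least_plot PW => {W P}.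
move=> n U p Up k V a [Vo aV]; split=> // v0 Vv0.
have fstV : smooth_on V (fst \o (sval \o a)).
  by apply: (smooth_on_linear Vo _ aV) => z; exact: cvg_fst.
have sndV : smooth_on V (snd \o (sval \o a)).
  by apply: (smooth_on_linear Vo _ aV) => z; exact: cvg_snd.
exists V, n, U, p, Up, (fst \o (sval \o a)), (snd \o (sval \o a)).
split=> //; split=> // w _ /=.
by case: (a w) => -[x y] Uxy; exists Uxy.
Qed.

Lemma lift_coequalize m (W : set 'rV[R]_m) (P : 'rV[R]_m -> tbundle D)
    n (U : set 'rV[R]_n) p (Up : plot D U p) g v
    (g' : 'rV[R]_m -> 'rV[R]_n) w0 :
  is_lift W P Up g v -> W w0 -> smooth_on W g' -> g' @` W `<=` U ->
  (forall w, W w -> p (g w) = p (g' w)) -> g w0 = g' w0 ->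
  exists k (Z : set 'rV[R]_k) r (Zr : plot D Z r) A h C,
    [/\ factors U p Z r A h /\ A (g w0), open C /\ C w0
      & C `<=` [set w | h (g w) = h (g' w)]].
Proof.
move=> PW Ww0 gW' gW'U pg gg'; have [Wo gW _ _] := PW.
have [k [Z [r [A [h [C [Zr hA hC CE]]]]]]] :=
  coequalizing_refinement hX Up Wo Ww0 gW gW' (lift_image PW) gW'U pg gg'.
by exists k, Z, r, Zr, A, h, C.
Qed.

(** This is where filteredness yields additivity: a common plot alone leaves
    two base maps that agree only at w0 and after projection to X; the
    coequalizer makes them equal near w0. *)
Lemma common_lift m (W : set 'rV[R]_m) (P P' : 'rV[R]_m -> tbundle D) w0 :
  open W -> W w0 -> locally_lifts W P -> locally_lifts W P' ->
  (forall w, W w -> projT1 (P w) = projT1 (P' w)) ->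
  exists W' n (U : set 'rV[R]_n) p (Up : plot D U p) g v v',
    [/\ W' w0, is_lift W' P Up g v & is_lift W' P' Up g v'].
Proof.
move=> Wo Ww0 /(_ w0 Ww0) [W1 [n1 [U1 [p1 [U1p [g1 [v1 [W1w0 PW1]]]]]]]].
move=> /(_ w0 Ww0) [W2 [n2 [U2 [p2 [U2p [g2 [v2 [W2w0 PW2]]]]]]]] PP'.
have U1g : U1 (g1 w0) by apply: (lift_image PW1); exists w0.
have U2g : U2 (g2 w0) by apply: (lift_image PW2); exists w0.
have [|k [Z [r [A [f [B [f' [Zr [fA Ag] [fB Bg] ff']]]]]]]] :=
    common_refinement hX U1p U2p U1g U2g.
  by rewrite -(lift_proj PW1 W1w0) -(lift_proj PW2 W2w0) PP'.
have {}PW1 := lift_factors Zr PW1 fA; have {}PW2 := lift_factors Zr PW2 fB.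
set V1 := (X in is_lift X P) in PW1; set V2 := (X in is_lift X P') in PW2.
have V1o : open V1 by case: PW1.
have V2o : open V2 by case: PW2.
pose V := V1 `&` V2 `&` W; have Vo : open V by do 2!apply: openI => //.
have Vw0 : V w0 by [].
have VV1 : V `<=` V1 by move=> w [[]].
have VV2 : V `<=` V2 by move=> w [[]].
have V1P := liftS Vo VV1 PW1; have V2P := liftS Vo VV2 PW2.
have [_ gV2 _ _] := V2P.
have [||l [Y [s [Ys [E [h [C [[hE Eg] [Co Cw0] CE]]]]]]]] :=
    lift_coequalize V1P Vw0 gV2 (lift_image V2P).
- move=> w Vw; rewrite -(lift_proj V1P Vw) -(lift_proj V2P Vw) PP' //.
  by case: Vw.
- exact: ff'.
have {}V1P := lift_factors Ys V1P hE; have {}V2P := lift_factors Ys V2P hE.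
set O1 := (X in is_lift X P) in V1P; set O2 := (X in is_lift X P') in V2P.
have O1o : open O1 by case: V1P.
have O2o : open O2 by case: V2P.
pose N := O1 `&` O2 `&` C; have No : open N by do 2!apply: openI => //.
exists N, l, Y, s, Ys, (h \o (f \o g1)).
eexists; eexists; split.
- split=> //; split; split=> //; rewrite /mkset /= -?ff' //.
- apply: (liftS No _ V1P) => w [[]] //.
- apply: lift_eq (liftS No _ V2P) => //; last by move=> w [[]].
  by move=> w [_ /CE].
Qed.

Lemma hector_dvs_over : is_dvs_over D (hector D).
Proof.
split; first exact: hector_proj.
- move=> m W P [PW PW']; apply: locally_lifts_hector.
    exact: plot_open PW.
  move=> w0 Ww0.
  have [|W' [n [U [p [Up [g [v [v' [W'w0 PE PE']]]]]]]]] :=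
    common_lift (plot_open PW) Ww0 (hector_lifts PW) (hector_lifts PW').
    by move=> w _ /=; exact: (svalP (P w)).
  exists W', n, U, p, Up, g, (fun w => v w + v' w); split=> //.
  exact: lift_add.
- move=> m W P [PW [Wo aW]]; apply: locally_lifts_hector => // w0 Ww0.
  have [W' [n [U [p [Up [g [v [W'w0 PW']]]]]]]] := hector_lifts PW Ww0.
  have W'o : open W' by case: PW'.
  exists (W' `&` W), n, U, p, Up, g, (fun w => snd (P w) *: v w); split=> //.
  have IW : W' `&` W `<=` W by move=> ? [].
  have IW' : W' `&` W `<=` W' by move=> ? [].
  have PI := liftS (openI W'o Wo) IW' PW'.
  exact: lift_eq (lift_scale (smooth_onS IW aW) PI).
Qed.

Lemma tfiber_dvs x : is_dvs (tfiber (hector D) x).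
Proof.
have [_ addH scaleH] := hector_dvs_over; split=> m W P [PW PW'].
- pose Q w : {ab | fiber_square (F := itangent D) ab} :=
    exist (fun ab => fiber_square (F := itangent D) ab)
      (existT (itangent D) x (P w).1, existT (itangent D) x (P w).2) erefl.
  exact: (addH _ _ Q (conj PW PW')).
- pose Q w := (existT (itangent D) x (P w).1, (P w).2).
  exact: (scaleH _ _ Q (conj PW PW')).
Qed.

(** A lift staying over x has base map g with p \o g constant, so g can be
    coequalized with its value at w0; afterwards all the vectors are
    represented at one pointed plot. *)
Lemma tfiber_fine x : tfiber (hector D) x = fine_diffeology (itangent D x).
Proof.
apply: diffeologyP => m W P; split; last exact/least_plot/tfiber_dvs.
move=> PW; have Wo := plot_open PW; apply: plot_local => w0 Ww0.
have [W1 [n [U [p [Up [g [v [W1w0 PW1]]]]]]]] := hector_lifts PW Ww0.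
have W1o : open W1 by case: PW1.
have Ug0 : U (g w0) by apply: (lift_image PW1); exists w0.
have [||||k [Z [r [Zr [A [h [C [[hA Ag] [Co Cw0] CE]]]]]]]] :=
    lift_coequalize (g' := fun=> g w0) PW1 W1w0.
- exact: smooth_on_cst.
- by move=> _ [_ _ <-].
- by move=> w W1w; rewrite -(lift_proj PW1 W1w) -(lift_proj PW1 W1w0).
- by [].
have {}PW1 := lift_factors Zr PW1 hA.
set V := (X in is_lift X _) in PW1.
have Vo : open V by case: PW1.
pose N := V `&` C `&` W; have No : open N by do 2!apply: openI => //.
have NV : N `<=` V by move=> w [[]].
have Nw0 : N w0 by [].
have hE w : N w -> (h \o g) w = h (g w0) by move=> [[_ /CE]].
have {}PW1 := lift_eq (fun w _ => erefl) hE (liftS No NV PW1).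
have [_ _ vN PN] := PW1; have [Zz _] := PN w0 Nw0.
exists N; split=> //; first by move=> w [].
apply: (fiber_linear (Q := translate Zr Zz) No Nw0 vN) => w Nw.
have [Zz' /= ->] := PN w Nw.
by rewrite tplotE (Prop_irrelevance Zz' Zz).
Qed.

End filtered.

Theorem theorem3 (R : realType) (X : Type) (D : diffeology R X)
    (hX : filtered_space D) :
  [/\ is_dvs_over D (hector D),
      hector D = tdvs D
    & forall x : X, tfiber (hector D) x = fine_diffeology (itangent D x)].
Proof.
split; [exact: hector_dvs_over| |by move=> x; exact: tfiber_fine].
apply: diffeologyP => n U p; split.
- by move=> Hp; split; [exact: plot_open Hp|move=> E [hE _]; exact: hE].
- by apply: least_plot; split=> //; exact: hector_dvs_over.
Qed.
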